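(* Define integers $a_{\mathcal{G}}(n)$, $n\ge0$, by $a_{\mathcal{G}}(0)=1$, $a_{\mathcal{G}}(1)=-1$, $a_{\mathcal{G}}(2)=-1$ and, for $n\ge 3$, $$a_{\mathcal{G}}(n)=-\frac12\left(\sum_{k=0}^{n-2}a_{\mathcal{G}}(k)\binom{n-1}{k}2^{n-1-k}+\sum_{k=0}^{n-1}a_{\mathcal{G}}(k)\binom{n}{k}2^{n-k}\right).$$ Write $\operatorname{sech}(x)=\sum_{n\ge0}s_n\frac{x^n}{n!}$. Then $s_{2n+1}=0$ and $s_{2n}=a_{\mathcal{G}}(2n)$ for all $n\ge 0$. *)

(* Defs.v *)
From Stdlib Require Import Reals Lra Lia Arith.
From Coquelicot Require Import Coquelicot.
Open Scope R_scope.

Definition aG_step (a : nat -> R) (n : nat) : R :=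
  match n with
  | 0%nat => 1
  | 1%nat => -1
  | 2%nat => -1
  | _ =>
      - (1 / 2) *
      (sum_f_R0 (fun k => a k * Binomial.C (n - 1) k * 2 ^ (n - 1 - k)) (n - 2)
       + sum_f_R0 (fun k => a k * Binomial.C n k * 2 ^ (n - k)) (n - 1))
  end.

(* [aG_fuel m n] is the intended value as soon as [n < m]; the recursion that
   [aG] satisfies is [aG_eq] below. *)
Fixpoint aG_fuel (m : nat) : nat -> R :=
  match m with
  | 0%nat => fun _ => 0
  | S m' => aG_step (aG_fuel m')
  end.

Definition aG (n : nat) : R := aG_fuel (S n) n.

Lemma aG_step_ext (a b : nat -> R) (n : nat) :
  (forall k, (k < n)%nat -> a k = b k) -> aG_step a n = aG_step b n.
Proof.
  intros H. destruct n as [|[|[|n]]]; try reflexivity.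
  unfold aG_step. do 2 f_equal; apply sum_eq; intros k Hk;
    rewrite H by lia; reflexivity.
Qed.

Lemma aG_fuel_indep (m p n : nat) :
  (n < m)%nat -> (n < p)%nat -> aG_fuel m n = aG_fuel p n.
Proof.
  revert p n; induction m as [|m IH]; intros [|p] n Hm Hp; try lia.
  simpl. apply aG_step_ext. intros k Hk. apply IH; lia.
Qed.

Lemma aG_eq (n : nat) : aG n = aG_step aG n.
Proof.
  unfold aG at 1. simpl. apply aG_step_ext. intros k Hk.
  apply aG_fuel_indep; lia.
Qed.

Lemma aG_0 : aG 0 = 1. Proof. reflexivity. Qed.
Lemma aG_1 : aG 1 = -1. Proof. reflexivity. Qed.
Lemma aG_2 : aG 2 = -1. Proof. reflexivity. Qed.

Lemma aG_rec (n : nat) : (3 <= n)%nat ->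
  aG n = - (1 / 2) *
    (sum_f_R0 (fun k => aG k * Binomial.C (n - 1) k * 2 ^ (n - 1 - k)) (n - 2)
     + sum_f_R0 (fun k => aG k * Binomial.C n k * 2 ^ (n - k)) (n - 1)).
Proof.
  intros Hn. rewrite aG_eq. destruct n as [|[|[|n]]]; try lia. reflexivity.
Qed.

Definition sech (x : R) : R := / cosh x.

Definition sech_expansion (s : nat -> R) : Prop :=
  locally 0 (fun x : R =>
    is_pseries (fun n => s n / INR (fact n)) x (sech x)).

(* Main.v *)
Require Import Defs.
From Stdlib Require Import Reals Lra Lia Arith.
From Coquelicot Require Import Coquelicot.
Open Scope R_scope.

(** Let [E = sech].  Then [E + E' = exp (-x) / cosh^2 x], so that
    [exp (2 x) (E + E') = E - E'].  Hence, if [s] is the coefficient sequence of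
    [E] and [u n = s n + s (n + 1)], the binomial convolution of [u] with the
    powers of [2] is [s n - s (n + 1)], and this is exactly what the recursion
    of [aG] says about [u].  Thus [aG n = s n + s (n + 1)]; since [E] is even,
    [s] vanishes at odd indices and [aG (2 n) = s (2 n)].  Integrality follows
    from [E cosh = 1], which expresses [s n] as an integer combination of
    earlier terms.  The same relation, solved recursively, gives coefficients
    bounded by [n!], hence a convergent expansion of [sech]. *)

(** * Power series expansions at 0 *)

(** [sech_expansion s] is by conversion [expands (fun n => s n / INR (fact n)) sech], so the lemmas
    on [expands] apply to it directly. *)
Definition expands (a : nat -> R) (f : R -> R) : Prop :=
  locally 0 (fun x : R => is_pseries a x (f x)).

Lemma expands_everywhere (a : nat -> R) (f : R -> R) :
  (forall x, is_pseries a x (f x)) -> expands a f.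
Proof. intros H. unfold expands. now apply filter_forall. Qed.

(** The terms of a convergent series tend to 0, which fails strictly outside the disk of
    convergence. *)
Lemma CV_radius_ge_ex_pseries (a : nat -> R) (x : R) :
  ex_pseries a x -> Rbar_le (Rabs x) (CV_radius a).
Proof.
  intros Hx. apply Rbar_not_lt_le. intros H.
  apply (CV_disk_outside a x H), ex_series_lim_0.
  destruct Hx as [l Hl]. exists l. now apply is_pseries_R.
Qed.

Lemma expands_CV_radius_gt_0 (a : nat -> R) (f : R -> R) :
  expands a f -> Rbar_lt 0 (CV_radius a).
Proof.
  intros [d Hd].
  assert (d2 : 0 < d / 2) by (destruct d; simpl; lra).
  (* A single nonzero point of convergence suffices; [d / 2] lies inside the ball of radius [d]. *)
  apply Rbar_lt_le_trans with (Rabs (d / 2)).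
  - simpl. rewrite Rabs_pos_eq; lra.
  - apply CV_radius_ge_ex_pseries. exists (f (d / 2)). apply Hd.
    change (Rabs (d / 2 - 0) < d). rewrite Rminus_0_r, Rabs_pos_eq; lra.
Qed.

Lemma expands_inside (a : nat -> R) (f : R -> R) :
  expands a f -> locally 0 (fun x : R => Rbar_lt (Rabs x) (CV_radius a)).
Proof.
  intros H. apply expands_CV_radius_gt_0 in H.
  destruct (CV_radius a) as [r| |]; try easy.
  - exists (mkposreal r H). intros x Hx.
    change (Rabs (x - 0) < r) in Hx. now rewrite Rminus_0_r in Hx.
  - now apply filter_forall.
Qed.

Lemma expands_eq (a b : nat -> R) (f g : R -> R) :
  expands a f -> expands b g -> (forall x, f x = g x) -> forall n, a n = b n.
Proof.
  intros Ha Hb Hfg n.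
  apply PSeries_ext_recip.
  - now apply expands_CV_radius_gt_0 with f.
  - now apply expands_CV_radius_gt_0 with g.
  - generalize (filter_and _ _ Ha Hb). apply filter_imp. intros x [H1 H2].
    rewrite (is_pseries_unique _ _ _ H1), (is_pseries_unique _ _ _ H2).
    apply Hfg.
Qed.

Lemma expands_ext (a b : nat -> R) (f : R -> R) :
  (forall n, a n = b n) -> expands a f -> expands b f.
Proof.
  intros Hab. unfold expands. apply filter_imp. intros x.
  now apply is_pseries_ext.
Qed.

Lemma expands_plus (a b : nat -> R) (f g : R -> R) :
  expands a f -> expands b g -> expands (PS_plus a b) (fun x => f x + g x).
Proof.
  intros Ha Hb. unfold expands. generalize (filter_and _ _ Ha Hb). apply filter_imp.
  intros x [H1 H2]. exact (is_pseries_plus _ _ _ _ _ H1 H2).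
Qed.

Lemma expands_minus (a b : nat -> R) (f g : R -> R) :
  expands a f -> expands b g -> expands (PS_minus a b) (fun x => f x - g x).
Proof.
  intros Ha Hb. unfold expands. generalize (filter_and _ _ Ha Hb). apply filter_imp.
  intros x [H1 H2]. exact (is_pseries_minus _ _ _ _ _ H1 H2).
Qed.

Lemma expands_mult (a b : nat -> R) (f g : R -> R) :
  expands a f -> expands b g -> expands (PS_mult a b) (fun x => f x * g x).
Proof.
  intros Ha Hb. unfold expands.
  generalize (filter_and _ _ (filter_and _ _ Ha Hb)
    (filter_and _ _ (expands_inside _ _ Ha) (expands_inside _ _ Hb))).
  apply filter_imp. intros x [[H1 H2] [H3 H4]].
  now apply is_pseries_mult.
Qed.

(** Each [x] close enough to 0 has a whole neighbourhood on which [f] agrees with [PSeries a]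
    ([locally_locally]), so the two derivatives at [x] coincide and termwise differentiation
    applies. *)
Lemma expands_derive (a : nat -> R) (f g : R -> R) :
  expands a f -> (forall x, is_derive f x (g x)) -> expands (PS_derive a) g.
Proof.
  intros Ha Hg. unfold expands.
  generalize (filter_and _ _ (locally_locally _ _ Ha)
    (expands_inside _ _ Ha)).
  apply filter_imp. intros x [H1 H2].
  replace (g x) with (Derive (PSeries a) x).
  - now apply is_pseries_derive.
  - rewrite <- (is_derive_unique _ _ _ (Hg x)).
    apply Derive_ext_loc. revert H1. apply filter_imp.
    intros y Hy. now apply is_pseries_unique.
Qed.

Lemma expands_reflect (a : nat -> R) (f : R -> R) :
  expands a f -> expands (fun n => a n * (-1) ^ n) (fun x => f (- x)).
Proof.
  intros [d Hd]. exists d. intros x Hx.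
  assert (H : is_pseries a (- x) (f (- x))).
  { apply Hd. change (Rabs (- x - 0) < d). change (Rabs (x - 0) < d) in Hx.
    replace (- x - 0) with (- (x - 0)) by ring. now rewrite Rabs_Ropp. }
  apply is_pseries_R. apply is_pseries_R in H. revert H. apply is_series_ext.
  intros n. simpl. replace (- x) with (-1 * x) by ring. rewrite Rpow_mult_distr. ring.
Qed.

Lemma expands_one : expands (fun n => match n with O => 1 | _ => 0 end) (fun _ => 1).
Proof.
  apply expands_everywhere. intros x. apply is_pseries_R, is_series_Reals.
  intros eps Heps. exists 0%nat. intros n _.
  replace (sum_f_R0 _ n) with 1.
  - now rewrite R_dist_eq.
  - induction n as [|n IH]; simpl; [ring|]. rewrite <- IH. ring.
Qed.

Lemma expands_exp (c : R) :
  expands (fun n => c ^ n / INR (fact n)) (fun x => exp (c * x)).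
Proof.
  apply expands_everywhere. intros x. apply is_pseries_R.
  generalize (proj1 (is_pseries_R _ _ _) (is_exp_Reals (c * x))).
  apply is_series_ext. intros n. simpl. rewrite Rpow_mult_distr. unfold Rdiv. ring.
Qed.

(** The indicator of even [n], in closed form so that it matches the average of the series of
    [exp x] and [exp (- x)]. *)
Definition cosh_coef (n : nat) : R := (1 + (-1) ^ n) / 2.

Lemma is_pseries_cosh (x : R) :
  is_pseries (fun n => cosh_coef n / INR (fact n)) x (cosh x).
Proof.
  unfold cosh. apply is_pseries_R.
  generalize (is_series_scal (/ 2) _ _
    (is_series_plus _ _ _ _
      (proj1 (is_pseries_R _ _ _) (is_exp_Reals x))
      (proj1 (is_pseries_R _ _ _) (is_exp_Reals (- x))))).
  replace ((exp x + exp (- x)) / 2)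
    with (scal (/ 2) (plus (exp x) (exp (- x)))).
  - apply is_series_ext. intros n. unfold scal, plus, cosh_coef; simpl.
    unfold mult; simpl.
    replace (- x) with (-1 * x) by ring. rewrite Rpow_mult_distr.
    unfold Rdiv. ring.
  - unfold scal, plus; simpl. unfold mult; simpl. field.
Qed.

Lemma expands_cosh : expands (fun n => cosh_coef n / INR (fact n)) cosh.
Proof. apply expands_everywhere. exact is_pseries_cosh. Qed.

(** A Cauchy product of exponential generating functions becomes a binomial convolution, since
    [n! / (k! (n - k)!)] is the binomial coefficient. *)
Lemma PS_mult_egf (u v : nat -> R) (n : nat) :
  PS_mult (fun n => u n / INR (fact n)) (fun n => v n / INR (fact n)) n =
  sum_f_R0 (fun k => u k * Binomial.C n k * v (n - k)%nat) n / INR (fact n).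
Proof.
  unfold PS_mult, Rdiv. rewrite (Rmult_comm (sum_f_R0 _ n)), scal_sum.
  apply sum_eq. intros k Hk. unfold Binomial.C.
  field. repeat split; apply INR_fact_neq_0.
Qed.

(** * Existence of the expansion of sech *)

(** [F n] looks only below [n], so any fuel exceeding [n] gives the same value at [n]. *)
Lemma course_of_values_recursion (F : nat -> (nat -> R) -> R) :
  (forall n f g, (forall k, (k < n)%nat -> f k = g k) -> F n f = F n g) ->
  exists f : nat -> R, forall n, f n = F n f.
Proof.
  intros HF.
  pose (fuel := fix fuel (m : nat) : nat -> R :=
    match m with O => fun _ => 0 | S m' => fun n => F n (fuel m') end).
  assert (Hfuel : forall m p n, (n < m)%nat -> (n < p)%nat -> fuel m n = fuel p n).
  { induction m as [|m IH]; intros [|p] n Hm Hp; try lia.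
    simpl. apply HF. intros k Hk. apply IH; lia. }
  exists (fun n => fuel (S n) n). intros n.
  simpl. apply HF. intros k Hk. apply (Hfuel n (S k) k); lia.
Qed.

Lemma cosh_coef_0_or_1 (n : nat) : cosh_coef n = 0 \/ cosh_coef n = 1.
Proof.
  unfold cosh_coef. induction n as [|n IH]; simpl; [right|]; lra.
Qed.

Lemma pow2_le_fact (n : nat) : 2 ^ n <= INR (fact (S n)).
Proof.
  induction n as [|n IH]; [simpl; lra|].
  change (fact (S (S n))) with (S (S n) * fact (S n))%nat.
  rewrite mult_INR. simpl (2 ^ S n). apply Rmult_le_compat; try lra.
  - apply pow_le; lra.
  - rewrite 2!S_INR. generalize (pos_INR n). lra.
Qed.

Lemma cosh_coef_term_bound (n : nat) :
  0 <= cosh_coef (S n) / INR (fact (S n)) <= / 2 ^ n.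
Proof.
  assert (H2 : 0 < 2 ^ n) by (apply pow_lt; lra).
  assert (Hf := INR_fact_lt_0 (S n)).
  assert (Hi := Rinv_0_lt_compat _ Hf).
  assert (Hle := Rinv_le_contravar _ _ H2 (pow2_le_fact n)).
  unfold Rdiv.
  destruct (cosh_coef_0_or_1 (S n)) as [-> | ->]; lra.
Qed.

(** Comparison with a geometric sum: passing from [n] to [S n] adds one term, at most [/ 2 ^ S n],
    in front of the previous sum. *)
Lemma cosh_coef_sum_bound (n : nat) :
  sum_f_R0 (fun k => cosh_coef (S n - k) / INR (fact (S n - k))) n <= 1 - / 2 ^ n.
Proof.
  induction n as [|n IH].
  - unfold cosh_coef; simpl. lra.
  - rewrite decomp_sum by lia. simpl pred. rewrite Nat.sub_0_r.
    assert (H := cosh_coef_term_bound (S n)).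
    assert (H2 : / 2 ^ n = / 2 ^ S n + / 2 ^ S n).
    { simpl. field. apply pow_nonzero. lra. }
    change (fun i => cosh_coef (S (S n) - S i) / INR (fact (S (S n) - S i)))
      with (fun k => cosh_coef (S n - k) / INR (fact (S n - k))).
    lra.
Qed.

(** The equation is solved for its top coefficient [t n], possible because cosh has constant term 1.
    The remaining coefficients of cosh are nonnegative with partial sums below 1, so the bound
    [Rabs (t n) <= 1] propagates by strong induction. *)
Lemma cosh_inverse_coefs : exists t : nat -> R,
  (forall n, Rabs (t n) <= 1) /\
  (forall n, PS_mult t (fun n => cosh_coef n / INR (fact n)) n =
             match n with O => 1 | _ => 0 end).
Proof.
  pose (c := fun n => cosh_coef n / INR (fact n)).
  destruct (course_of_values_recursion (fun n t =>
    match n with O => 1 | S m => - sum_f_R0 (fun k => t k * c (S m - k)%nat) m end))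
    as [t Ht].
  { intros [|n] f g Hfg; [reflexivity|]. f_equal. apply sum_eq.
    intros k Hk. rewrite Hfg by lia. reflexivity. }
  exists t. split.
  - intros n. induction n as [n IH] using (well_founded_induction lt_wf).
    rewrite Ht. destruct n as [|n]; [rewrite Rabs_R1; lra|].
    rewrite Rabs_Ropp.
    apply Rle_trans with (1 := Rsum_abs _ _).
    apply Rle_trans with (sum_f_R0 (fun k => c (S n - k)%nat) n).
    + apply sum_Rle. intros k Hk. rewrite Rabs_mult.
      assert (Hc := cosh_coef_term_bound (n - k)).
      replace (S (n - k)) with (S n - k)%nat in Hc by lia.
      fold (c (S n - k)%nat) in Hc.
      rewrite (Rabs_pos_eq (c _)) by lra.
      rewrite <- (Rmult_1_l (c (S n - k)%nat)) at 2.
      apply Rmult_le_compat_r; [lra|]. apply IH. lia.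
    + assert (H := cosh_coef_sum_bound n).
      assert (0 < / 2 ^ n) by (apply Rinv_0_lt_compat, pow_lt; lra).
      unfold c. lra.
  - intros n. fold c. unfold PS_mult. destruct n as [|n].
    + simpl. rewrite Ht. unfold c, cosh_coef. simpl. field.
    (* The last term is [t (S n) * c 0] with [c 0 = 1]; by the recursion it cancels the rest. *)
    + rewrite tech5, Nat.sub_diag.
      rewrite (Ht (S n)). unfold c at 3, cosh_coef. simpl (fact 0). simpl (_ ^ 0).
      simpl (INR 1). field.
Qed.

Lemma cosh_gt_0 (x : R) : 0 < cosh x.
Proof.
  unfold cosh. generalize (exp_pos x) (exp_pos (- x)). lra.
Qed.

(** Bounded coefficients give radius at least 1, and near 0 the sum of the series times cosh is 1,
    so it equals sech there. *)
Lemma sech_expansion_exists : exists s : nat -> R, sech_expansion s.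
Proof.
  destruct cosh_inverse_coefs as [t [Hb Ht]].
  assert (Hr : Rbar_le 1 (CV_radius t)).
  { apply CV_radius_bounded. exists 1. intros n. rewrite pow1, Rmult_1_r. apply Hb. }
  assert (Hexp : expands t (PSeries t)).
  { exists (mkposreal 1 Rlt_0_1). intros x Hx.
    change (Rabs (x - 0) < 1) in Hx. rewrite Rminus_0_r in Hx.
    apply PSeries_correct, CV_radius_inside.
    now apply Rbar_lt_le_trans with 1. }
  (* The factorial offsets the division by [n!] in [sech_expansion]. *)
  exists (fun n => t n * INR (fact n)). unfold sech_expansion.
  generalize (filter_and _ _ Hexp
    (filter_and _ _ expands_one (expands_mult _ _ _ _ Hexp expands_cosh))).
  apply filter_imp. intros x [H1 [H2 H3]].
  assert (H : PSeries t x * cosh x = 1).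
  { rewrite <- (is_pseries_unique _ _ _ H2).
    rewrite <- (is_pseries_unique _ _ _ H3).
    apply PSeries_ext. exact Ht. }
  replace (sech x) with (PSeries t x).
  - revert H1. apply is_pseries_ext. intros n. simpl. field. apply INR_fact_neq_0.
  - unfold sech. apply Rmult_eq_reg_r with (cosh x).
    + rewrite H. field. apply Rgt_not_eq, cosh_gt_0.
    + apply Rgt_not_eq, cosh_gt_0.
Qed.

(** * Coefficients of sech *)

(** Evenness of sech and uniqueness of coefficients give [s n = (-1) ^ n * s n]. *)
Lemma sech_coef_odd (s : nat -> R) (n : nat) :
  sech_expansion s ->
  s (2 * n + 1)%nat = 0.
Proof.
  intros Hs. assert (H := expands_eq _ _ _ _ Hs (expands_reflect _ _ Hs)).
  assert (Hev : forall x, sech x = sech (- x)).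
  { intros x. unfold sech, cosh. rewrite Ropp_involutive. f_equal. lra. }
  specialize (H Hev (2 * n + 1)%nat). cbv beta in H.
  replace ((-1) ^ (2 * n + 1)) with (-1) in H
    by (rewrite Nat.add_1_r; now rewrite pow_1_odd).
  assert (H0 : s (2 * n + 1)%nat / INR (fact (2 * n + 1)) = 0) by lra.
  replace (s (2 * n + 1)%nat)
    with (s (2 * n + 1)%nat / INR (fact (2 * n + 1)) * INR (fact (2 * n + 1)))
    by (field; apply INR_fact_neq_0).
  rewrite H0. ring.
Qed.

Lemma sech_coef_cosh (s : nat -> R) (n : nat) :
  sech_expansion s ->
  sum_f_R0 (fun k => s k * Binomial.C n k * cosh_coef (n - k)) n =
  match n with O => 1 | _ => 0 end.
Proof.
  intros Hs. assert (H := expands_eq _ _ _ _ (expands_mult _ _ _ _ Hs expands_cosh) expands_one).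
  assert (H1 : forall x, sech x * cosh x = 1).
  { intros x. unfold sech. field. apply Rgt_not_eq, cosh_gt_0. }
  specialize (H H1 n). rewrite PS_mult_egf in H.
  assert (Hf := INR_fact_neq_0 n).
  replace (sum_f_R0 _ n) with
    (sum_f_R0 (fun k => s k * Binomial.C n k * cosh_coef (n - k)) n
       / INR (fact n) * INR (fact n)) by now field.
  rewrite H. destruct n; simpl; ring.
Qed.

Lemma is_derive_sech (x : R) : is_derive sech x (- sinh x / cosh x ^ 2).
Proof.
  apply is_derive_inv.
  - apply is_derive_Reals, derivable_pt_lim_cosh.
  - apply Rgt_not_eq, cosh_gt_0.
Qed.

Lemma PS_derive_egf (u : nat -> R) (n : nat) :
  PS_derive (fun n => u n / INR (fact n)) n = u (S n) / INR (fact n).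
Proof.
  unfold PS_derive. rewrite fact_simpl, mult_INR. field.
  split; [apply INR_fact_neq_0 | apply not_0_INR; lia].
Qed.

Lemma sech_coef_conv (s : nat -> R) (n : nat) :
  sech_expansion s ->
  sum_f_R0 (fun k => (s k + s (S k)) * Binomial.C n k * 2 ^ (n - k)) n =
  s n - s (S n).
Proof.
  intros Hs. assert (Hd := expands_derive _ _ _ Hs is_derive_sech).
  assert (Hp : expands (fun n => (s n + s (S n)) / INR (fact n))
                 (fun x => sech x + - sinh x / cosh x ^ 2)).
  { generalize (expands_plus _ _ _ _ Hs Hd). apply expands_ext.
    intros k. unfold PS_plus.
    rewrite PS_derive_egf. unfold plus; simpl. field. apply INR_fact_neq_0. }
  assert (H := expands_eq _ _ _ _ (expands_mult _ _ _ _ Hp (expands_exp 2))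
                 (expands_minus _ _ _ _ Hs Hd)).
  assert (He : forall x, (sech x + - sinh x / cosh x ^ 2) * exp (2 * x) =
                         sech x - - sinh x / cosh x ^ 2).
  { intros x. assert (Hc := cosh_gt_0 x). unfold sech.
    replace (2 * x) with (x + x) by ring. rewrite exp_plus.
    assert (H1 : exp x = cosh x + sinh x) by (unfold cosh, sinh; field).
    assert (H2 : cosh x * cosh x - sinh x * sinh x = 1).
    { assert (Hi : exp x * exp (- x) = 1)
        by (rewrite <- exp_plus, Rplus_opp_r; apply exp_0).
      unfold cosh, sinh. nra. }
    rewrite H1.
    (* The sum of sech and its derivative is [(cosh x - sinh x) / cosh x ^ 2]; one factor
       [cosh x + sinh x] completes the difference of squares, which is 1. *)
    replace ((/ cosh x + - sinh x / cosh x ^ 2) *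
             ((cosh x + sinh x) * (cosh x + sinh x)))
      with ((cosh x * cosh x - sinh x * sinh x) * (cosh x + sinh x) / cosh x ^ 2)
      by (field; lra).
    rewrite H2. field. lra. }
  specialize (H He n). rewrite (PS_mult_egf (fun n => s n + s (S n))) in H.
  unfold PS_minus, PS_plus, PS_opp in H. rewrite PS_derive_egf in H.
  unfold plus, opp in H; simpl in H.
  assert (Hf := INR_fact_neq_0 n).
  apply Rmult_eq_reg_r with (/ INR (fact n)).
  - unfold Rdiv in H. rewrite H. ring.
  - now apply Rinv_neq_0_compat.
Qed.

Lemma sech_coef_0 (s : nat -> R) : sech_expansion s -> s 0%nat = 1.
Proof.
  intros Hs. generalize (sech_coef_cosh s 0 Hs). unfold cosh_coef, Binomial.C; simpl. lra.
Qed.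

Lemma sech_coef_2 (s : nat -> R) : sech_expansion s -> s 2%nat = -1.
Proof.
  intros Hs. generalize (sech_coef_cosh s 2 Hs) (sech_coef_0 s Hs).
  unfold cosh_coef, Binomial.C; simpl. lra.
Qed.

Lemma aG_sech_coef (s : nat -> R) (n : nat) :
  sech_expansion s ->
  aG n = s n + s (S n).
Proof.
  intros Hs. assert (H1 := sech_coef_odd s 0 Hs). assert (H3 := sech_coef_odd s 1 Hs).
  simpl in H1, H3.
  induction n as [n IH] using (well_founded_induction lt_wf).
  destruct n as [|[|[|m]]].
  - rewrite aG_0, H1, (sech_coef_0 s Hs). ring.
  - rewrite aG_1, H1, (sech_coef_2 s Hs). ring.
  - rewrite aG_2, H3, (sech_coef_2 s Hs). ring.
  - rewrite aG_rec by lia.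
    replace (S (S (S m)) - 1)%nat with (S (S m)) by lia.
    replace (S (S (S m)) - 2)%nat with (S m) by lia.
    assert (Ha := sech_coef_conv s (S (S m)) Hs).
    assert (Hb := sech_coef_conv s (S (S (S m))) Hs).
    (* Write [n] for [S (S (S m))]. Removing the top terms [s (n - 1) + s n] and [s n + s (n + 1)]
       from the two convolutions leaves [-2 * s n] and [-2 * s (n + 1)], the two sums in the
       recursion of [aG n]. *)
    rewrite tech5, C_n_n, Nat.sub_diag in Ha, Hb. simpl (2 ^ 0) in Ha, Hb.
    rewrite (sum_eq (fun k => aG k * Binomial.C (S (S m)) k * 2 ^ (S (S m) - k))
               (fun k => (s k + s (S k)) * Binomial.C (S (S m)) k * 2 ^ (S (S m) - k)))
      by (intros k Hk; rewrite IH by lia; reflexivity).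
    rewrite (sum_eq (fun k => aG k * Binomial.C (S (S (S m))) k * 2 ^ (S (S (S m)) - k))
               (fun k => (s k + s (S k)) * Binomial.C (S (S (S m))) k
                         * 2 ^ (S (S (S m)) - k)))
      by (intros k Hk; rewrite IH by lia; reflexivity).
    lra.
Qed.

(** * Integrality *)

Definition is_integer (x : R) : Prop := exists z : Z, x = IZR z.

Lemma is_integer_plus (x y : R) : is_integer x -> is_integer y -> is_integer (x + y).
Proof. intros [a ->] [b ->]. exists (a + b)%Z. now rewrite plus_IZR. Qed.

Lemma is_integer_mult (x y : R) : is_integer x -> is_integer y -> is_integer (x * y).
Proof. intros [a ->] [b ->]. exists (a * b)%Z. now rewrite mult_IZR. Qed.

Lemma is_integer_opp (x : R) : is_integer x -> is_integer (- x).
Proof. intros [a ->]. exists (- a)%Z. now rewrite opp_IZR. Qed.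

Lemma is_integer_sum (f : nat -> R) (n : nat) :
  (forall k, (k <= n)%nat -> is_integer (f k)) -> is_integer (sum_f_R0 f n).
Proof.
  induction n as [|n IH]; intros H; simpl.
  - now apply H.
  - apply is_integer_plus; [apply IH; intros k Hk|]; apply H; lia.
Qed.

(** [Binomial.C] is a real quotient of factorials, so integrality comes from Pascal's rule; the
    diagonal is separate because [pascal] requires a strict inequality. *)
Lemma is_integer_C (n k : nat) : (k <= n)%nat -> is_integer (Binomial.C n k).
Proof.
  revert k. induction n as [|n IH]; intros k Hk.
  - replace k with 0%nat by lia. exists 1%Z. apply C_n_0.
  - destruct k as [|k]; [exists 1%Z; apply C_n_0|].
    destruct (Nat.eq_dec k n) as [->|Hkn]; [exists 1%Z; apply C_n_n|].
    rewrite <- pascal by lia. apply is_integer_plus; apply IH; lia.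
Qed.

Lemma is_integer_cosh_coef (n : nat) : is_integer (cosh_coef n).
Proof.
  destruct (cosh_coef_0_or_1 n) as [-> | ->]; [now exists 0%Z | now exists 1%Z].
Qed.

Lemma is_integer_sech_coef (s : nat -> R) :
  sech_expansion s -> forall n, is_integer (s n).
Proof.
  intros Hs n. induction n as [n IH] using (well_founded_induction lt_wf).
  destruct n as [|n]; [exists 1%Z; now apply sech_coef_0|].
  assert (H := sech_coef_cosh s (S n) Hs).
  (* The coefficient of [s (S n)] is 1, so solving for it involves no division. *)
  rewrite tech5, C_n_n, Nat.sub_diag in H.
  unfold cosh_coef at 2 in H. simpl (_ ^ 0) in H.
  replace (s (S n)) with
    (- sum_f_R0 (fun k => s k * Binomial.C (S n) k * cosh_coef (S n - k)) n) by lra.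
  apply is_integer_opp, is_integer_sum. intros k Hk.
  apply is_integer_mult; [apply is_integer_mult|].
  - apply IH. lia.
  - apply is_integer_C. lia.
  - apply is_integer_cosh_coef.
Qed.

Theorem mainTheorem7 :
  (forall n : nat, exists z : Z, aG n = IZR z) /\
  (exists s : nat -> R, sech_expansion s) /\
  (forall s : nat -> R, sech_expansion s ->
     forall n : nat, s (2 * n + 1)%nat = 0 /\ s (2 * n)%nat = aG (2 * n)).
Proof.
  split; [|split].
  (* Integrality of [aG] is read off from an expansion of sech, so the existence result is what
     supplies [s] here. *)
  - intros n. destruct sech_expansion_exists as [s Hs].
    rewrite (aG_sech_coef s _ Hs).
    apply is_integer_plus; now apply is_integer_sech_coef.
  - exact sech_expansion_exists.
  - intros s Hs n. assert (H := sech_coef_odd s n Hs). split; [exact H|].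
    rewrite (aG_sech_coef s _ Hs). rewrite Nat.add_1_r in H. rewrite H. ring.
Qed.
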